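(* The numbers $e(\mathcal{PB}_n)$ satisfy the recurrence $e(\mathcal{PB}_0)=1$ and, for $n\ge1$, $$e(\mathcal{PB}_n)=\sum_{i=1}^{\lfloor\frac n2\rfloor}\binom{n-1}{2i-1}(2i+1)\cdot(2i-1)!\;e(\mathcal{PB}_{n-2i})+2\cdot\sum_{i=0}^{\lfloor\frac{n-1}2\rfloor}\binom{n-1}{2i}(2i+1)!\;e(\mathcal{PB}_{n-2i-1}).$$
   Context: Write $\mathbf n=\{1,\dots,n\}$ and let $\mathbf n'$ be a disjoint copy. The partial Brauer monoid $\mathcal{PB}_n$ is the set of all set partitions $\alpha$ of $\mathbf n\cup\mathbf n'$ into non-empty blocks of size at most $2$ ($\mathcal{PB}_0=\{\emptyset\}$). Product: for $\alpha,\beta\in\mathcal{PB}_n$ take a third copy $\mathbf n''$; relabel each lower vertex $x'$ of $\alpha$ as $x''$ and each upper vertex $x$ of $\beta$ as $x''$, and take the union graph $\Gamma(\alpha,\beta)$ on $\mathbf n\cup\mathbf n'\cup\mathbf n''$ (blocks of size $2$ being viewed as edges); $x,y\in\mathbf n\cup\mathbf n'$ are in the same block of $\alpha\beta$ iff they are joined by a path in $\Gamma(\alpha,\beta)$. $e(\mathcal{PB}_n)$ is the number of $\alpha\in\mathcal{PB}_n$ with $\alpha^2=\alpha$. *)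

(* Defs.v *)
From mathcomp Require Import all_boot.

Set Implicit Arguments.
Unset Strict Implicit.
Unset Printing Implicit Defensive.

(* The vertices of n \cup n': [inl i] is the upper vertex i + 1 and [inr i] is
   the lower vertex (i + 1)'. *)
Definition vertex (n : nat) : finType := ('I_n + 'I_n)%type.

Definition PB (n : nat) : {set {set {set vertex n}}} :=
  [set a | partition a [set: vertex n] & [forall B in a, #|B| <= 2]].

(* The vertices of n \cup n' \cup n'': [inl] marks the vertices of n \cup n',
   and [inr i] is the middle vertex (i + 1)''. *)
Definition pvertex (n : nat) : finType := (vertex n + 'I_n)%type.

Definition lower_to_middle (n : nat) (v : vertex n) : pvertex n :=
  match v with
  | inl i => inl (inl i)
  | inr i => inr i
  end.

Definition upper_to_middle (n : nat) (v : vertex n) : pvertex n :=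
  match v with
  | inl i => inr i
  | inr i => inl (inr i)
  end.

(* Adjacency in the product graph Gamma(a, b): since u != v, only the blocks of
   size 2 contribute edges. *)
Definition product_graph (n : nat) (a b : {set {set vertex n}}) :
    rel (pvertex n) :=
  fun u v => (u != v) &&
    ([set u; v] \in [set @lower_to_middle n @: B | B : {set vertex n} in a]
                :|: [set @upper_to_middle n @: B | B : {set vertex n} in b]).

Definition pbmul (n : nat) (a b : {set {set vertex n}}) :
    {set {set vertex n}} :=
  equivalence_partition
    (fun x y => connect (product_graph a b) (inl x) (inl y)) [set: vertex n].

Definition e_PB (n : nat) : nat := #|[set a in PB n | pbmul a a == a]|.

(* Main.v *)
Require Import Defs.
From mathcomp Require Import all_boot.
From mathcomp Require Import fingroup perm action zify.

Set Implicit Arguments.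
Unset Strict Implicit.
Unset Printing Implicit Defensive.

(** A diagram of [PB n] is given by two partial matchings of the points
    1, ..., n, one formed by its upper blocks and one by its lower blocks, and
    by its transversal blocks.  Encode the matchings as involutions [u] and [l],
    a fixed point of [u] being an upper vertex that lies in a singleton or in a
    transversal block.  In the product graph of a diagram with itself the
    middle row carries both matchings, so the paths through the middle row run
    inside the orbits of the group generated by [u] and [l].  These orbits are
    paths and cycles whose edges come alternately from [u] and [l].  It follows
    that the diagram is idempotent iff each transversal joins two points of one
    orbit ([idempotentP]).  The upper end of a transversal is fixed by [u] and
    its lower end by [l]; both belong to one orbit only if they are the two
    ends of a path with an odd number of vertices.  So an idempotent amounts to
    a pair [(u, l)] together with a choice, for each orbit that is a path of
    odd size, of whether its ends are joined by a transversal
    ([e_PB_weight]): the count is the sum over all pairs of 2 to the number of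
    such orbits.

    This sum is multiplicative over the orbits.  Splitting off the orbit [B]
    of a chosen point ([weight_rec]) leaves the same problem on the complement
    of [B], and the recurrence follows once the pairs with the single orbit
    [B] are counted.  Let [k] be the size of [B] and [p = u * l].  If the orbit
    is a path then [p] is a cyclic permutation of [B] and [u] is one of the [k]
    reflections of this cycle, which gives [(k-1)! * k] pairs
    ([card_path_pairs]).  If it is a cycle then [k] is even, and walking along
    the cycle, by an edge of [u] first, is a cyclic permutation of [B] that
    determines the pair, which gives [(k-1)!] pairs ([card_cycle_pairs]).
    Hence an orbit of even size [k = 2i] contributes [(2i-1)! * (2i+1)], and
    one of odd size [k = 2i+1] contributes [2 * (2i+1)!].  The binomial
    coefficients count the possible orbits of the chosen point by size. *)

(** * Orbits of two involutions *)

Section PorbitExtras.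

Variable T : finType.
Implicit Types (p q : {perm T}) (x y : T) (B : {set T}).

Lemma porbit_expM p x m : (p ^+ (m * #|porbit p x|))%g x = x.
Proof.
elim: m => [|m IHm]; first by rewrite expg0 perm1.
by rewrite mulSn expgD permM [(p ^+ #|_|)%g x]permX iter_porbit.
Qed.

Lemma dvdn_porbit p x m : (p ^+ m)%g x = x -> #|porbit p x| %| m.
Proof.
set k := #|_| => pm; have k_gt0 : 0 < k by rewrite lt0n card_porbit_neq0.
have pr : (p ^+ (m %% k))%g x = x.
  by rewrite -[RHS]pm {2}(divn_eq m k) expgD permM porbit_expM.
apply/eqP/(@uniqP _ x _ (uniq_traject_porbit p x));
  rewrite ?inE ?size_traject ?ltn_mod // !nth_traject ?ltn_mod //.
by rewrite -permX.
Qed.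

Lemma porbit_stable p x y : (p y \in porbit p x) = (y \in porbit p x).
Proof. by rewrite -!eq_porbit_mem -[p y]/((p ^+ 1)%g y) porbit_perm. Qed.

Lemma porbitV_stable p x y : ((p^-1)%g y \in porbit p x) = (y \in porbit p x).
Proof. by rewrite -porbitV porbit_stable porbitV. Qed.

Lemma porbit_min p B x :
  x \in B -> (forall y, y \in B -> p y \in B) -> porbit p x \subset B.
Proof.
move=> xB pB; apply/subsetP => _ /porbitP[m ->].
by elim: m => [|m IHm]; rewrite ?expg0 ?perm1 // expgSr permM pB.
Qed.

Lemma eq_in_porbit p q B x :
    x \in B -> (forall y, y \in B -> p y \in B) -> {in B, p =1 q} ->
  porbit p x = porbit q x.
Proof.
move=> xB pB pq.
have E m : (p ^+ m)%g x \in B /\ (q ^+ m)%g x = (p ^+ m)%g x.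
  elim: m => [|m [IH1 IH2]]; first by rewrite !expg0 perm1.
  by rewrite !expgSr !permM IH2 pq // -pq // pB.
by apply/setP => y; apply/porbitP/porbitP => -[m ->]; exists m; rewrite (E m).2.
Qed.

End PorbitExtras.

Section Dihedral.

Variable T : finType.
Implicit Types (u l : {perm T}) (x y z : T).

(** [u] conjugates [u * l] to its inverse: the two involutions generate a
    dihedral group whose rotation is [u * l]. *)
Lemma dihedral_exp u l m x : involutive u -> involutive l ->
  u (((u * l) ^+ m)%g x) = ((u * l) ^- m)%g (u x).
Proof.
move=> uu ll; elim: m x => [|m IHm] x; first by rewrite !expg0 invg1 !perm1.
rewrite {1}expgS permM IHm expgSr invMg [RHS]permM; congr ((_ : {perm T}) _).
by apply: (canRL (permK (u * l))); rewrite !permM uu ll.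
Qed.

Lemma mulg_invol u l : involutive u -> involutive l -> (l * u = (u * l)^-1)%g.
Proof.
move=> uu ll; apply/permP => x.
by apply: (canRL (permK (u * l))); rewrite !permM uu ll.
Qed.

Lemma porbit_swap u l : involutive u -> involutive l ->
  porbit (l * u) =1 porbit (u * l).
Proof. by move=> uu ll x; rewrite mulg_invol // porbitV. Qed.

Lemma dihedral_porbit u l x y : involutive u -> involutive l ->
  (u y \in porbit (u * l) (u x)) = (y \in porbit (u * l) x).
Proof.
move=> uu ll; suff H a b :
    b \in porbit (u * l) a -> u b \in porbit (u * l) (u a).
  by apply/idP/idP => [/H | /H //]; rewrite !uu.
case/porbitP => m ->; rewrite dihedral_exp // -porbitV -expgVn.
exact: mem_porbit.
Qed.

Lemma porbit_reflect u l x y : involutive u -> involutive l ->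
  (l y \in porbit (u * l) (u x)) = (y \in porbit (u * l) x).
Proof.
move=> uu ll; rewrite -[l y](uu _) dihedral_porbit //.
have <- : ((u * l)^-1 y)%g = u (l y); last exact: porbitV_stable.
by rewrite -mulg_invol // permM.
Qed.

(** At an end of a path the dihedral orbit is already an orbit of the
    rotation, because the reflection fixing the end maps that orbit to
    itself. *)
Lemma porbit_fixed_stable u l x y : involutive u -> involutive l ->
    u x = x \/ l x = x ->
  (u y \in porbit (u * l) x) = (y \in porbit (u * l) x) /\
  (l y \in porbit (u * l) x) = (y \in porbit (u * l) x).
Proof.
move=> uu ll [e|e]; split; rewrite -{1}e.
- exact: dihedral_porbit.
- exact: porbit_reflect.
- by rewrite -!(porbit_swap uu ll) porbit_reflect.
- by rewrite -!(porbit_swap uu ll) dihedral_porbit.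
Qed.

(** If [z] is the rotation of [y] by [m] steps then [u] sends it to the rotation
    by [-m] steps, so the orbit size divides [2 * m], hence [m]. *)
Lemma odd_fixed_eq u l y z : involutive u -> involutive l ->
    odd #|porbit (u * l) y| -> z \in porbit (u * l) y -> u y = y -> u z = z ->
  z = y.
Proof.
move=> uu ll odd_k /porbitP[m ->] uy; rewrite dihedral_exp // uy => e.
have: (((u * l) ^+ (2 * m)) y = y)%g.
  by rewrite mulSn mul1n expgD permM -{1}e permKV.
move/dvdn_porbit; rewrite Gauss_dvdr ?coprimen2 // => /dvdnP[q ->].
exact: porbit_expM.
Qed.

(** [l] sends the rotation of [y] by [m] steps to the rotation by [1 - m]
    steps, so it fixes it iff the orbit size divides [2 * m - 1].  This can be
    solved for [m] exactly when the size is odd. *)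
Lemma odd_lower_end u l y : involutive u -> involutive l -> u y = y ->
  (exists2 z, z \in porbit (u * l) y & l z = z) <-> odd #|porbit (u * l) y|.
Proof.
move=> uu ll uy.
have lE m : l (((u * l) ^+ m)%g y) = ((u * l)%g (((u * l) ^- m)%g y)).
  by rewrite permM -{2}uy -dihedral_exp // uu.
move: (u * l)%g lE => p lE; set k := #|_|.
split=> [[_ /porbitP[m ->]] | odd_k].
  rewrite lE => e.
  have: (p ^+ (2 * m))%g y = p y.
    rewrite mulSn mul1n expgD permM -{1}e -permM.
    by rewrite -expgS expgSr permM permKV.
  (* for m = 0 the point y is fixed by u and by l, and its orbit has size 1 *)
  case: m {e} => [|m].
    rewrite muln0 expg0 perm1 => e.
    have /dvdn_porbit : (p ^+ 1)%g y = y by [].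
    by rewrite dvdn1 => /eqP; rewrite /k => ->.
  rewrite mulnS expgSr permM => /perm_inj/dvdn_porbit.
  by move/dvdn_odd; apply; lia.
exists ((p ^+ (k.+1./2))%g y); first exact: mem_porbit.
rewrite lE; have: (p ^+ k)%g y = y by rewrite -[k]mul1n porbit_expM.
have -> : k.+1./2 = k./2.+1 by lia.
have {1}-> : k = k./2 + k./2.+1 by lia.
by move=> e; rewrite -{1}e expgD permM permK -permM -expgSr.
Qed.

(** The ends not covered by [u] of the paths with an odd number of vertices:
    one point for each such path. *)
Definition odd_ends u l : {set T} :=
  [set y | (u y == y) && odd #|porbit (u * l) y|].

(** The default value [y] is only taken off [odd_ends u l]. *)
Definition other_end u l y : T :=
  odflt y [pick z in porbit (u * l) y | l z == z].

Lemma other_endE u l y z : involutive u -> involutive l ->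
    y \in odd_ends u l -> z \in porbit (u * l) y -> l z = z ->
  other_end u l y = z.
Proof.
move=> uu ll /[!inE] /andP[/eqP uy odd_k] yz lz; rewrite /other_end.
case: pickP => [w /andP[yw /eqP lw] | /(_ z)]; last by rewrite yz lz eqxx.
have Ez : porbit (u * l) y = porbit (u * l) z.
  by apply/esym/eqP; rewrite eq_porbit_mem.
by apply: (@odd_fixed_eq l u) => //; rewrite porbit_swap // -Ez.
Qed.

(** Exchanging the roles of [u] and [l] reverses the path, so that [other_end]
    with the arguments exchanged is the inverse bijection. *)
Lemma other_endP u l y : involutive u -> involutive l -> y \in odd_ends u l ->
  [/\ other_end u l y \in porbit (u * l) y, other_end u l y \in odd_ends l u
    & other_end l u (other_end u l y) = y].
Proof.
move=> uu ll yO; case/setIdP: (yO) => /eqP uy odd_k.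
have [z yz lz] := (odd_lower_end uu ll uy).2 odd_k.
rewrite (other_endE uu ll yO yz lz).
have Ez : porbit (u * l) z = porbit (u * l) y.
  by apply/eqP; rewrite eq_porbit_mem.
have zO : z \in odd_ends l u by rewrite inE lz eqxx porbit_swap // Ez.
by split=> //; apply: other_endE; rewrite // porbit_swap // porbit_sym.
Qed.

End Dihedral.

(** * Diagrams as involutions *)

Section Diagrams.

Variable n : nat.
Implicit Types (f g : vertex n -> vertex n) (v w : vertex n) (x y : 'I_n).
Implicit Types (a : {set {set vertex n}}) (u l : {perm 'I_n}) (S : {set 'I_n}).

Definition blocks f : {set {set vertex n}} :=
  [set [set v; f v] | v in [set: vertex n]].

Lemma mem_blocks f v : [set v; f v] \in blocks f.
Proof. by apply/imsetP; exists v. Qed.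

Lemma blocks_PB f : involutive f -> blocks f \in PB n.
Proof.
move=> ff; rewrite inE; apply/andP; split; last first.
  by apply/forall_inP => _ /imsetP[v _ ->]; rewrite cards2; case: (_ != _).
apply/and3P; split.
- apply/eqP/setP => v; rewrite inE; apply/bigcupP.
  by exists [set v; f v]; rewrite ?mem_blocks ?set21.
- apply/trivIsetP => _ _ /imsetP[v _ ->] /imsetP[w _ ->] neq.
  apply/pred0P => z /=; apply: contraNF neq; rewrite !inE.
  case/andP=> /orP[]/eqP-> /orP[]/eqP => [->|->|<-|/(inv_inj ff)->];
    by rewrite ?ff // eqEsubset !subUset !sub1set !set21 !set22.
- by apply/imsetP => -[v _ /setP/(_ v)]; rewrite !inE eqxx.
Qed.

Lemma blocksP f v w : involutive f ->
  reflect (exists2 B, B \in blocks f & (v \in B) && (w \in B))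
          (w \in [set v; f v]).
Proof.
move=> ff; apply: (iffP idP) => [vw | [_ /imsetP[z _ ->]]].
  by exists [set v; f v]; rewrite ?mem_blocks // set21.
rewrite !inE => /andP[/orP[]/eqP-> /orP[]/eqP->]; by rewrite ?ff eqxx ?orbT.
Qed.

Lemma blocks_inj f g : involutive f -> involutive g ->
  blocks f = blocks g -> f =1 g.
Proof.
move=> ff gg E.
have H v : [set v; f v] = [set v; g v].
  by apply/setP=> w; apply/(blocksP v w ff)/(blocksP v w gg); rewrite E.
move=> v; have: g v \in [set v; f v] by rewrite H set22.
have: f v \in [set v; g v] by rewrite -H set22.
by rewrite !inE => /orP[/eqP-> | /eqP //]; rewrite orbb => /eqP.
Qed.

(** The involution exchanges the two elements of each block of size 2. *)
Lemma PB_blocks a : a \in PB n -> exists2 f, involutive f & a = blocks f.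
Proof.
rewrite inE => /andP[/and3P[/eqP cov triv n0] /forall_inP le2].
have memv v : v \in cover a by rewrite cov.
pose f v := odflt v [pick w in pblock a v | w != v].
have fE v : pblock a v = [set v; f v].
  have va := le2 _ (pblock_mem (memv v)).
  rewrite /f; case: pickP => [w /andP[vw neq] | none] /=; last first.
    apply/setP => w; rewrite !inE orbb; apply/idP/eqP => [vw|->].
      by move: (none w); rewrite vw /= => /negbFE/eqP.
    by rewrite mem_pblock.
  apply/esym/eqP; rewrite eqEcard subUset !sub1set vw mem_pblock memv /=.
  by rewrite cards2 eq_sym neq.
have pf v : pblock a (f v) = pblock a v.
  by apply/esym/eqP; rewrite eq_pblock // fE set22.
have ff : involutive f.
  move=> v; have := set21 v (f v); rewrite -fE -pf fE !inE => /orP[|/eqP //].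
  by move/eqP=> e; rewrite -!e.
exists f => //; apply/setP => B; apply/idP/imsetP => [Ba | [v _ ->]].
  have /set0Pn[v vB] : B != set0 by apply: contraNneq n0 => <-.
  by exists v; rewrite // -fE (def_pblock triv Ba vB).
by rewrite -fE pblock_mem.
Qed.

End Diagrams.

(** * Idempotent diagrams *)

Lemma connect_closed (T : finType) (e : rel T) (P : pred T) x y :
  (forall z w, e z w -> P z -> P w) -> connect e x y -> P x -> P y.
Proof.
move=> eP /connectP[s]; elim: s x => [|z s IHs] x /=; first by move=> _ ->.
by case/andP=> exz pth lst Px; apply: (IHs z) => //; apply: eP Px.
Qed.

Section Idempotents.

Variable n : nat.
Implicit Types (f g : vertex n -> vertex n) (v w : vertex n) (x y z : 'I_n).
Implicit Types (u l : {perm 'I_n}) (S : {set 'I_n}) (s t : pvertex n).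

Lemma product_graphP f g s t : involutive f -> involutive g ->
  reflect (s <> t /\
           ((exists v, s = lower_to_middle v /\ t = lower_to_middle (f v)) \/
            (exists v, s = upper_to_middle v /\ t = upper_to_middle (g v))))
          (product_graph (blocks f) (blocks g) s t).
Proof.
move=> ff gg.
have pair (h : vertex n -> pvertex n) (k : vertex n -> vertex n) :
    involutive k -> s <> t ->
    reflect (exists v, s = h v /\ t = h (k v))
            ([set s; t] \in [set h @: B | B : {set vertex n} in blocks k]).
  move=> kk neq; apply: (iffP imsetP) => [[_ /imsetP[v _ ->]] | [v [-> ->]]].
    rewrite imsetU !imset_set1 => E.
    have: s \in [set h v; h (k v)] by rewrite -E set21.
    have: t \in [set h v; h (k v)] by rewrite -E set22.
    rewrite !inE => /orP[]/eqP et /orP[]/eqP es.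
    - by case: neq; rewrite es et.
    - by exists (k v); rewrite kk.
    - by exists v.
    - by case: neq; rewrite es et.
  by exists [set v; k v]; rewrite ?mem_blocks // imsetU !imset_set1.
rewrite /product_graph; case: eqP => [-> | neq] /=; first by constructor => -[].
rewrite inE; apply: (iffP orP) => [[/pair|/pair] H | [_ [H|H]]].
- by split=> //; left; apply: H.
- by split=> //; right; apply: H.
- by left; apply/pair.
- by right; apply/pair.
Qed.

Definition joined f v w :=
  connect (product_graph (blocks f) (blocks f)) (inl v) (inl w).

Lemma product_graph_sym f : involutive f ->
  symmetric (product_graph (blocks f) (blocks f)).
Proof.
move=> ff s t; rewrite /product_graph eq_sym.
by rewrite setUC [in RHS]setUC [[set s; t]]setUC.
Qed.

(** Both sides are partitions into classes of an equivalence relation, hence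
    equal iff the relations agree. *)
Lemma pbmul_blocks_idem f : involutive f ->
  pbmul (blocks f) (blocks f) = blocks f <->
  forall v w, joined f v w = (w \in [set v; f v]).
Proof.
move=> ff.
have Esym : connect_sym (product_graph (blocks f) (blocks f)).
  exact/sym_connect_sym/product_graph_sym.
have pbE : pbmul (blocks f) (blocks f) =
    [set [set w | joined f v w] | v in [set: vertex n]].
  by apply: eq_imset => v; apply/setP => w; rewrite !inE.
split=> [E v w | E].
  have: [set w | joined f v w] \in blocks f.
    by rewrite -E pbE; apply/imsetP; exists v.
  case/imsetP => z _ Ez.
  have: v \in [set z; f z] by rewrite -Ez inE /joined connect0.
  have -> : joined f v w = (w \in [set z; f z]) by rewrite -Ez inE.
  by case/set2P=> ->; rewrite // ff setUC.
by rewrite pbE; apply: eq_imset => v; apply/setP => w; rewrite inE E.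
Qed.

(** The upper and lower matchings of [f] as permutations, the vertices on
    transversals being turned into fixed points. *)
Definition matchings_of f u l :=
  (forall x, u x = if f (inl x) is inl y then y else x) /\
  (forall x, l x = if f (inr x) is inr y then y else x).

Lemma matchings_of_invol f u l : involutive f -> matchings_of f u l ->
  involutive u /\ involutive l.
Proof.
move=> ff [uE lE]; split=> x.
  rewrite !uE; case Ex: (f (inl x)) => [y|y]; last by rewrite Ex.
  by rewrite -Ex ff.
rewrite !lE; case Ex: (f (inr x)) => [y|y]; first by rewrite Ex.
by rewrite -Ex ff.
Qed.

(** Upper blocks survive in the first copy and lower blocks in the second; only
    the transversals need an argument. *)
Lemma joined_block f v w : involutive f ->
  (forall x y, f (inl x) = inr y -> joined f (inl x) (inr y)) ->
  w \in [set v; f v] -> joined f v w.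
Proof.
move=> ff trans.
have tsym s t : connect (product_graph (blocks f) (blocks f)) s t =
    connect (product_graph (blocks f) (blocks f)) t s.
  exact/sym_connect_sym/product_graph_sym.
case/set2P => ->; first exact: connect0.
case: v => x; case E: (f _) => [y|y].
- have [->|neq] := eqVneq x y; first exact: connect0.
  apply/connect1/product_graphP => //; split; first by case=> /eqP; apply/negP.
  by left; exists (inl x); rewrite E.
- exact: trans.
- by rewrite /joined tsym; apply: trans; rewrite -E ff.
- have [->|neq] := eqVneq x y; first exact: connect0.
  apply/connect1/product_graphP => //; split; first by case=> /eqP; apply/negP.
  by right; exists (inr x); rewrite E.
Qed.

(** The middle row carries the edges of [l], coming from the first factor, and
    those of [u], coming from the second one. *)
Lemma middle_connect f u l x y : involutive f -> matchings_of f u l ->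
  y \in porbit (u * l) x ->
  connect (product_graph (blocks f) (blocks f)) (inr x) (inr y).
Proof.
move=> ff [uE lE] /porbitP[m ->]; elim: m => [|m IHm].
  by rewrite expg0 perm1 connect0.
apply: connect_trans IHm _; rewrite expgSr !permM; set z := (_ x).
have step a b :
   (exists v, inr a = upper_to_middle v /\ inr b = upper_to_middle (f v)) \/
   (exists v, inr a = lower_to_middle v /\ inr b = lower_to_middle (f v)) ->
   connect (product_graph (blocks f) (blocks f)) (inr a) (inr b).
  move=> H; have [->|neq] := eqVneq a b; first exact: connect0.
  apply/connect1/product_graphP => //; split; first by case=> /eqP; apply/negP.
  by case: H; [right | left].
apply: (@connect_trans _ _ (inr (u z))).
  have := uE z; case E: (f (inl z)) => [w|w] ->; last exact: connect0.
  by apply: step; left; exists (inl z); rewrite E.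
have := lE (u z); case E: (f (inr (u z))) => [w|w] ->; first exact: connect0.
by apply: step; right; exists (inr (u z)); rewrite E.
Qed.

(** A transversal from [x] to [y] gives the edge from [x] to the middle vertex
    [y] and the edge from the middle vertex [x] to [y].  It persists in the
    product iff the middle vertices [x] and [y] are connected.  When they are,
    their orbit is a path with ends [x] and [y] that meets no further
    transversal, so that nothing else gets joined. *)
Lemma idempotentP f u l : involutive f -> matchings_of f u l ->
  pbmul (blocks f) (blocks f) = blocks f <->
  forall x y, f (inl x) = inr y -> y \in porbit (u * l) x.
Proof.
move=> ff mf; have [uu ll] := matchings_of_invol ff mf; have [uE lE] := mf.
have ux x y : f (inl x) = inr y -> u x = x by move=> E; rewrite uE E.
have ly x y : f (inl x) = inr y -> l y = y by move=> E; rewrite lE -E ff.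
rewrite pbmul_blocks_idem //; split=> [J x y E | T v w].
  have Jxy : joined f (inl x) (inr y) by rewrite J E set22.
  (* P is the component that the path from x to y has to stay in: the orbit of
     y in the middle row with the outer ends of the transversals leaving it *)
  pose P (s : pvertex n) := match s with
    | inl (inl z) =>
        if f (inl z) is inr w then w \in porbit (u * l) y else false
    | inl (inr z) =>
        if f (inr z) is inl w then w \in porbit (u * l) y else false
    | inr z => z \in porbit (u * l) y
    end.
  have stab z := porbit_fixed_stable z uu ll (or_intror (ly _ _ E)).
  suff: P (inl (inr y)) by rewrite /P -E ff porbit_sym.
  apply: connect_closed Jxy _; last by rewrite /P E porbit_id.
  move=> _ _ /product_graphP-/(_ ff ff)[_ [] [[a|a] [-> ->]]];
    case Ea: (f _) => [b|b] /=; have := congr1 f Ea; rewrite ff => Eb;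
    rewrite ?Ea -?Eb //.
  - by rewrite -(stab a).2 lE Ea.
  - by rewrite -(stab a).1 uE Ea.
apply/idP/idP; last first.
  apply: joined_block => // x y E.
  apply: (@connect_trans _ _ (inr y)).
    apply/connect1/product_graphP => //; split => //.
    by left; exists (inl x); rewrite E.
  apply: (@connect_trans _ _ (inr x)); last first.
    apply/connect1/product_graphP => //; split => //.
    by right; exists (inl x); rewrite E.
  by apply: (middle_connect ff mf); rewrite porbit_sym; apply: T.
(* P consists of the block of v and, if this is a transversal, of the middle
   orbit that links its two ends *)
pose P (s : pvertex n) := match s with
  | inl z => z \in [set v; f v]
  | inr z => [exists x, [&& (inl x \in [set v; f v]), 
       (if f (inl x) is inr _ then true else false) & z \in porbit (u * l) x]]
  end.
have fB v1 : (f v1 \in [set v; f v]) = (v1 \in [set v; f v]).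
  by rewrite !inE orbC (can_eq ff) (can2_eq ff ff).
have uniq x x' y y' : f (inl x) = inr y -> f (inl x') = inr y' ->
    x' \in porbit (u * l) x -> x' = x.
  move=> E E'; have ux1 := ux _ _ E; have ux2 := ux _ _ E'.
  move=> xx'; apply: odd_fixed_eq xx' ux1 ux2 => //.
  apply/odd_lower_end => //; first exact: ux E.
  by exists y; [exact: T | exact: ly E].
move=> J; rewrite -[_ \in _]/(P (inl w)).
apply: connect_closed J _; last exact: set21.
move=> _ _ /product_graphP-/(_ ff ff)[_ [] [[a|a] [-> ->]]];
    case Ea: (f _) => [b|b] /=.
- by rewrite -fB Ea.
- move=> ax; apply/existsP; exists a; rewrite ax Ea; exact: T.
- case/existsP => x /and3P[xv]; case E: (f (inl x)) => // [y] _ xa.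
  have Eb : f (inl b) = inr a by rewrite -Ea ff.
  rewrite (@uniq x b y a) //.
  by move: xa (T _ _ Eb); rewrite -!eq_porbit_mem => /eqP->; rewrite eq_sym.
- case/existsP => x /and3P[xv Ex xa]; apply/existsP; exists x; rewrite xv Ex.
  have [y Exy] : exists y, f (inl x) = inr y.
    by case: (f _) Ex => // y; exists y.
  have := (porbit_fixed_stable a uu ll (or_introl (ux _ _ Exy))).2.
  by rewrite lE Ea => ->.
- case/existsP => x /and3P[xv Ex xa]; apply/existsP; exists x; rewrite xv Ex.
  have [y Exy] : exists y, f (inl x) = inr y.
    by case: (f _) Ex => // y; exists y.
  have := (porbit_fixed_stable a uu ll (or_introl (ux _ _ Exy))).1.
  by rewrite uE Ea => ->.
- case/existsP => x /and3P[xv]; case E: (f (inl x)) => // [y] _ xa.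
  by rewrite -Ea fB (@uniq x a y b).
- have Eb : f (inl b) = inr a by rewrite -Ea ff.
  move=> ax; apply/existsP; exists b; rewrite -fB Eb ax; exact: porbit_id.
- by rewrite -fB Ea.
Qed.

End Idempotents.

(** * Idempotents as weighted pairs of matchings *)

Section Weights.

Variable T : finType.
Implicit Types (A B : {set T}) (u l : {perm T}).

Definition matching A : {set {perm T}} :=
  [set u | perm_on A u & (u * u == 1)%g].

Lemma matchingP A u :
  reflect (perm_on A u /\ involutive u) (u \in matching A).
Proof.
rewrite inE; apply: (iffP andP) => -[uA uu]; split=> //.
  by move=> x; rewrite -permM (eqP uu) perm1.
by apply/eqP/permP => x; rewrite permM perm1.
Qed.

(** Points outside [A] are fixed by both involutions and would count as paths
    with one vertex; the intersection with [A] discards them. *)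
Definition weight A : nat :=
  \sum_(ul in setX (matching A) (matching A)) 2 ^ #|odd_ends ul.1 ul.2 :&: A|.

End Weights.

Section Encoding.

Variable n : nat.
Implicit Types (v w : vertex n) (x y z : 'I_n).
Implicit Types (u l : {perm 'I_n}) (S : {set 'I_n}).

(** The diagram with matchings [u] and [l] in which exactly the paths with their
    upper end in [S] have their two ends joined by a transversal. *)
Definition diagram u l S v : vertex n :=
  match v with
  | inl x => if x \in S then inr (other_end u l x) else inl (u x)
  | inr x => if (x \in odd_ends l u) && (other_end l u x \in S)
             then inl (other_end l u x) else inr (l x)
  end.

Section Valid.

Variables (u l : {perm 'I_n}) (S : {set 'I_n}).
Hypotheses (uu : involutive u) (ll : involutive l).
Hypothesis SO : S \subset odd_ends u l.

Lemma diagram_invol : involutive (diagram u l S).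
Proof.
case=> x /=; case: ifP => [xS | xS] /=.
- have [_ zO zx] := other_endP uu ll (subsetP SO _ xS).
  by rewrite zO zx xS.
- rewrite uu; case: ifP => // uxS.
  have := subsetP SO _ uxS; rewrite inE uu => /andP[/eqP e _].
  by rewrite e uxS in xS.
- case/andP: xS => xO zS; rewrite zS.
  by have [_ _ ->] := other_endP ll uu xO.
rewrite ll; case: ifP => // /andP[lxO lxS].
move: (lxO) lxS; rewrite inE ll => /andP[/eqP e _].
by rewrite -e in lxO *; move: xS; rewrite lxO /= => ->.
Qed.

Lemma diagram_matchings : matchings_of (diagram u l S) u l.
Proof.
split=> x /=; case: ifP => // xS.
  by have := subsetP SO _ xS; rewrite inE => /andP[/eqP].
by case/andP: xS; rewrite inE => /andP[/eqP].
Qed.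

Lemma diagram_idem :
  pbmul (blocks (diagram u l S)) (blocks (diagram u l S))
    = blocks (diagram u l S).
Proof.
apply/(idempotentP diagram_invol diagram_matchings) => x y /=.
case: ifP => // xS [<-].
by have [] := other_endP uu ll (subsetP SO _ xS).
Qed.

End Valid.

Lemma matchings_of_uniq f g u l u' l' :
  matchings_of f u l -> matchings_of g u' l' -> f =1 g -> u = u' /\ l = l'.
Proof.
move=> [uE lE] [uE' lE'] fg; split; apply/permP => x.
  by rewrite uE uE' fg.
by rewrite lE lE' fg.
Qed.

(** The transversal at an upper vertex [x] cannot end anywhere but at
    [other_end u l x], so [f] is recovered from its matchings and the set [S] of
    upper vertices on transversals. *)
Lemma idempotent_diagram f : involutive f ->
    pbmul (blocks f) (blocks f) = blocks f ->
  exists u l S, [/\ involutive u, involutive l, S \subset odd_ends u l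
                  & f =1 diagram u l S].
Proof.
move=> ff idem.
have inju : injective (fun x => if f (inl x) is inl y then y else x).
  apply: inv_inj => x; case Ex: (f (inl x)) => [y|y]; last by rewrite Ex.
  by rewrite -Ex ff.
have injl : injective (fun x => if f (inr x) is inr y then y else x).
  apply: inv_inj => x; case Ex: (f (inr x)) => [y|y]; first by rewrite Ex.
  by rewrite -Ex ff.
have mf : matchings_of f (perm inju) (perm injl) by split=> x; rewrite permE.
have [uu ll] := matchings_of_invol ff mf; have [uE lE] := mf.
move: (perm inju) (perm injl) mf uu ll uE lE => u l mf uu ll uE lE.
have T := (idempotentP ff mf).1 idem.
pose S := [set x | if f (inl x) is inr _ then true else false].
have endE x y : f (inl x) = inr y -> x \in odd_ends u l /\ other_end u l x = y.
  move=> E; have ux : u x = x by rewrite uE E.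
  have ly : l y = y by rewrite lE -E ff.
  have xO : x \in odd_ends u l.
    rewrite inE ux eqxx; apply/odd_lower_end => //.
    by exists y => //; apply: T.
  by split=> //; apply: other_endE => //; apply: T.
have SO : S \subset odd_ends u l.
  apply/subsetP => x; rewrite inE; case E: (f (inl x)) => [//|y] _.
  by have [] := endE _ _ E.
exists u, l, S; split=> // -[x|x] /=.
  rewrite inE uE; case E: (f (inl x)) => [//|y].
  by have [_ ->] := endE _ _ E.
case E: (f (inr x)) => [y|y].
  have Ey : f (inl y) = inr x by rewrite -E ff.
  have [yO ey] := endE _ _ Ey.
  have [_ ] := other_endP uu ll yO; rewrite ey => -> ->.
  by rewrite inE Ey.
case: ifP => [/andP[xO] | _]; last by rewrite lE E.
rewrite inE; case Ew: (f (inl _)) => [//|z] _.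
have [_ ez] := endE _ _ Ew.
have [_ _ e] := other_endP ll uu xO.
by move: Ew; rewrite -ez e => /(congr1 f); rewrite ff E.
Qed.

Lemma e_PB_weight : e_PB n = weight [set: 'I_n].
Proof.
pose D := [set t : {perm 'I_n} * {perm 'I_n} * {set 'I_n} |
  (t.1 \in setX (matching [set: 'I_n]) (matching [set: 'I_n]))
  && (t.2 \subset odd_ends t.1.1 t.1.2)].
have DP t : t \in D -> [/\ involutive t.1.1, involutive t.1.2
                          & t.2 \subset odd_ends t.1.1 t.1.2].
  case: t => [[u l] S]; rewrite inE in_setX.
  by case/andP=> /andP[/matchingP[_ uu] /matchingP[_ ll]] SO; split.
pose F (t : {perm 'I_n} * {perm 'I_n} * {set 'I_n}) :=
  blocks (diagram t.1.1 t.1.2 t.2).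
have injF : {in D &, injective F}.
  move=> [[u l] S] [[u' l'] S'] /DP[/= uu ll SO] /DP[/= uu' ll' SO'].
  move/(blocks_inj (diagram_invol uu ll SO) (diagram_invol uu' ll' SO')) => E.
  have [-> ->] :=
    matchings_of_uniq (diagram_matchings SO) (diagram_matchings SO') E.
  congr (_, _); apply/setP => x; have /= := E (inl x).
  by case: ifP; case: ifP.
have -> : e_PB n = #|D|.
  rewrite -(card_in_imset injF); apply: eq_card => a; apply/idP/imsetP.
    rewrite inE => /andP[/PB_blocks[f ff ->] /eqP idem].
    have [u [l [S [uu ll SO E]]]] := idempotent_diagram ff idem.
    exists (u, l, S); last by rewrite /F; apply: eq_imset => v; rewrite E.
    have on (p : {perm 'I_n}) : perm_on [set: 'I_n] p.
      by apply/subsetP => z; rewrite inE.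
    by rewrite inE in_setX SO andbT; apply/andP; split; apply/matchingP.
  case=> t /DP[uu ll SO] ->; rewrite inE blocks_PB; last exact: diagram_invol.
  by rewrite diagram_idem //=.
rewrite -sum1_card /weight.
transitivity (\sum_(ul in setX (matching [set: 'I_n]) (matching [set: 'I_n]))
    \sum_(S : {set 'I_n} | S \subset odd_ends ul.1 ul.2) 1).
  by rewrite pair_big_dep; apply: eq_bigl => t; rewrite inE.
apply: eq_bigr => ul _; rewrite setIT -card_powerset -sum1_card.
by apply: eq_bigl => S; rewrite inE.
Qed.

End Encoding.

(** * Splitting off one orbit *)

Section Components.

Variable T : finType.
Implicit Types (A B D : {set T}) (u l : {perm T}) (x y : T).

(** The orbit of [x] under the group generated by [u] and [l]: the rotations,
    and the rotations following the reflection [u]. *)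
Definition component u l x : {set T} :=
  porbit (u * l) x :|: porbit (u * l) (u x).

Lemma component_id u l x : x \in component u l x.
Proof. by rewrite inE porbit_id. Qed.

Lemma component_stable u l x y : involutive u -> involutive l ->
  y \in component u l x -> u y \in component u l x /\ l y \in component u l x.
Proof.
move=> uu ll; rewrite !inE => /orP[] yx; split; apply/orP.
- by right; rewrite dihedral_porbit.
- by right; rewrite porbit_reflect.
- by left; rewrite -[x]uu dihedral_porbit.
- by left; rewrite -[x]uu porbit_reflect.
Qed.

Lemma component_min u l x A : x \in A ->
  (forall y, y \in A -> u y \in A) -> (forall y, y \in A -> l y \in A) ->
  component u l x \subset A.
Proof.
move=> xA uA lA; rewrite subUset !porbit_min ?uA // => y yA;
  by rewrite permM lA ?uA.
Qed.

Section Agree.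

Variables (u l u' l' : {perm T}) (D : {set T}).
Hypotheses (uD : forall y, y \in D -> u y \in D).
Hypotheses (lD : forall y, y \in D -> l y \in D).
Hypotheses (uu' : {in D, u =1 u'}) (ll' : {in D, l =1 l'}).

Lemma porbit_agree y : y \in D -> porbit (u * l) y = porbit (u' * l') y.
Proof.
move=> yD; apply: (@eq_in_porbit _ _ _ D) => // z zD; rewrite !permM.
  by rewrite lD ?uD.
by rewrite ll' ?uD // uu'.
Qed.

Lemma component_agree y : y \in D -> component u l y = component u' l' y.
Proof.
by move=> yD; rewrite /component !porbit_agree ?uD // uu'.
Qed.

Lemma odd_ends_agree : odd_ends u l :&: D = odd_ends u' l' :&: D.
Proof.
apply/setP => y; rewrite !inE; case yD: (y \in D); rewrite ?andbF //.
by rewrite porbit_agree // uu'.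
Qed.

End Agree.

Lemma matching_stable A u y : u \in matching A -> y \in A -> u y \in A.
Proof. by case/matchingP => uA _; rewrite perm_closed. Qed.

Lemma matching_out A u y : u \in matching A -> y \notin A -> u y = y.
Proof. by case/matchingP => uA _ /(out_perm uA). Qed.

Lemma matching_restr A B u : u \in matching A -> B \subset A ->
    (forall y, y \in B -> u y \in B) ->
  restr_perm B u \in matching B /\ {in B, restr_perm B u =1 u}.
Proof.
move=> /matchingP[uA uu] BA uB.
have uN : u \in 'N(B | 'P)%g.
  by rewrite !inE; apply/subsetP => y yB; rewrite inE; apply: uB.
have E : {in B, restr_perm B u =1 u} by move=> y yB; apply: restr_permE.
split=> //; apply/matchingP; split; first exact: restr_perm_on.
move=> y; case yB: (y \in B); first by rewrite !E ?uB.
by rewrite !(out_perm (restr_perm_on B u)) ?yB.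
Qed.

(** Involutions supported on [B] and on its complement have disjoint supports,
    so their product acts as each of them on its own part. *)
Lemma glueE A B u v y : u \in matching B -> v \in matching (A :\: B) ->
  (u * v)%g y = if y \in B then u y else v y.
Proof.
move=> uB vD; rewrite permM; case: ifPn => yB.
  by rewrite (matching_out vD) // inE (matching_stable uB yB).
by rewrite (matching_out uB).
Qed.

Lemma glue_matching A B u v : B \subset A ->
  u \in matching B -> v \in matching (A :\: B) -> (u * v)%g \in matching A.
Proof.
move=> BA uB vD; have [uP uu] := matchingP _ _ uB.
have [vP vv] := matchingP _ _ vD.
apply/matchingP; split.
  rewrite perm_onM //; first exact: subset_trans uP BA.
  exact: subset_trans vP (subsetDl _ _).
move=> y; rewrite (glueE y uB vD); case: ifPn => yB; rewrite (glueE _ uB vD).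
  by rewrite (matching_stable uB) // uu.
case yA: (y \in A :\: B); last by rewrite !(matching_out vD) ?yA // (negbTE yB).
by have /setDP[_ /negbTE->] := matching_stable vD yA; rewrite vv.
Qed.

Definition connected_pairs B x :=
  [set ul in setX (matching B) (matching B) | component ul.1 ul.2 x == B].

Definition connected_weight B x :=
  \sum_(ul in connected_pairs B x) 2 ^ #|odd_ends ul.1 ul.2 :&: B|.

(** A pair whose component at [x] is [B] is the product of a connected pair on
    [B] and an arbitrary pair on the complement, and the odd ends are those of
    the two factors. *)
Lemma weight_component A B x : B \subset A -> x \in B ->
  \sum_(ul in setX (matching A) (matching A) | component ul.1 ul.2 x == B)
    2 ^ #|odd_ends ul.1 ul.2 :&: A| = connected_weight B x * weight (A :\: B).
Proof.
move=> BA xB.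
pose D := setX (connected_pairs B x)
               (setX (matching (A :\: B)) (matching (A :\: B))).
pose h (t : ({perm T} * {perm T}) * ({perm T} * {perm T})) :=
  ((t.1.1 * t.2.1)%g, (t.1.2 * t.2.2)%g).
have DP t : t \in D -> [/\ t.1.1 \in matching B, t.1.2 \in matching B,
    component t.1.1 t.1.2 x = B, t.2.1 \in matching (A :\: B)
    & t.2.2 \in matching (A :\: B)].
  case: t => [[u1 l1] [u2 l2]]; rewrite !in_setX inE in_setX /=.
  by case/andP=> /andP[/andP[? ?] /eqP ?] /andP[? ?]; split.
have glueB u v : u \in matching B -> v \in matching (A :\: B) ->
    {in B, u =1 (u * v)%g}.
  by move=> uB vD y yB; rewrite (glueE _ uB vD) yB.
have glueD u v : u \in matching B -> v \in matching (A :\: B) ->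
    {in A :\: B, v =1 (u * v)%g}.
  by move=> uB vD y /setDP[_ yB]; rewrite (glueE _ uB vD) (negbTE yB).
have injh : {in D &, injective h}.
  move=> [[u1 l1] [u2 l2]] [[u1' l1'] [u2' l2']].
  move=> /DP[/= u1B l1B _ u2D l2D] /DP[/= u1B' l1B' _ u2D' l2D'] [E1 E2].
  have sepB u v u' v' : u \in matching B -> v \in matching (A :\: B) ->
      u' \in matching B -> v' \in matching (A :\: B) ->
      (u * v = u' * v')%g -> u = u' /\ v = v'.
    move=> uB vD uB' vD' /permP E; split; apply/permP => y; have := E y;
      rewrite !(glueE _ uB vD) !(glueE _ uB' vD'); case: ifPn => //= yB.
    - by rewrite !(matching_out uB) ?(matching_out uB').
    - by rewrite !(matching_out vD) ?(matching_out vD') // inE yB.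
  have [-> ->] := sepB _ _ _ _ u1B u2D u1B' u2D' E1.
  by have [-> ->] := sepB _ _ _ _ l1B l2D l1B' l2D' E2.
transitivity (\sum_(ul in h @: D) 2 ^ #|odd_ends ul.1 ul.2 :&: A|).
  apply: eq_bigl => -[u l]; rewrite in_setX /=; apply/idP/imsetP; last first.
    case=> -[[u1 l1] [u2 l2]] /DP[/= u1B l1B cB u2D l2D] [-> ->].
    rewrite !(glue_matching BA) //=; apply/eqP; rewrite -[RHS]cB; apply/esym.
    apply: (@component_agree _ _ _ _ B) => //;
      by [apply: glueB | move=> y; apply: matching_stable].
  case/andP=> /andP[uA lA] /eqP cB.
  have [_ uu] := matchingP _ _ uA; have [_ ll] := matchingP _ _ lA.
  have uB y : y \in B -> u y \in B.
    by rewrite -cB => /(component_stable uu ll)[].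
  have lB y : y \in B -> l y \in B.
    by rewrite -cB => /(component_stable uu ll)[].
  have outD (v : {perm T}) :
      v \in matching A -> (forall y, y \in B -> v y \in B) ->
      forall y, y \in A :\: B -> v y \in A :\: B.
    move=> vA vB y /setDP[yA yB]; rewrite inE (matching_stable vA) // andbT.
    have [_ vv] := matchingP _ _ vA.
    by apply: contra yB => /vB; rewrite vv.
  have [ru1 eu1] := matching_restr uA BA uB.
  have [rl1 el1] := matching_restr lA BA lB.
  have [ru2 eu2] := matching_restr uA (subsetDl _ _) (outD _ uA uB).
  have [rl2 el2] := matching_restr lA (subsetDl _ _) (outD _ lA lB).
  have back v : v \in matching A -> restr_perm B v \in matching B ->
      restr_perm (A :\: B) v \in matching (A :\: B) ->
      {in B, restr_perm B v =1 v} ->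
      {in A :\: B, restr_perm (A :\: B) v =1 v} ->
      v = (restr_perm B v * restr_perm (A :\: B) v)%g.
    move=> vA v1 v2 e1 e2; apply/permP => y; rewrite (glueE _ v1 v2).
    case: ifPn => yB; first by rewrite e1.
    case yA: (y \in A); first by rewrite e2 // inE yB.
    by rewrite (matching_out vA) ?yA // (matching_out v2) // inE yA andbF.
  exists ((restr_perm B u, restr_perm B l),
          (restr_perm (A :\: B) u, restr_perm (A :\: B) l)); last first.
    by rewrite /h /= -!back.
  rewrite !in_setX inE in_setX /= ru1 rl1 ru2 rl2 !andbT /=.
  apply/eqP; rewrite -[RHS]cB; apply/esym.
  by apply: (@component_agree _ _ _ _ B) => // y yB; rewrite ?eu1 ?el1.
rewrite big_imset //= /connected_weight /weight big_distrlr /= pair_big /=.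
apply: eq_big => [[a b] | [[u1 l1] [u2 l2]]]; first by rewrite in_setX.
move=> /DP[/= u1B l1B _ u2D l2D]; rewrite -expnD; congr (2 ^ _).
have EB : odd_ends u1 l1 :&: B = odd_ends (u1 * u2) (l1 * l2) :&: B.
  by apply: odd_ends_agree;
    by [apply: glueB | move=> y; apply: matching_stable].
have ED : odd_ends u2 l2 :&: (A :\: B)
        = odd_ends (u1 * u2) (l1 * l2) :&: (A :\: B).
  by apply: odd_ends_agree;
    by [apply: glueD | move=> y; apply: matching_stable].
rewrite EB ED -(cardsID B (_ :&: A)); congr (_ + _); apply: eq_card => y.
  by rewrite !inE -andbA; case yB: (y \in B); rewrite ?andbF // (subsetP BA).
by rewrite !inE; case: (y \in A); case: (y \in B); rewrite ?andbF ?andbT.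
Qed.

Lemma weight_rec A x : x \in A ->
  weight A = \sum_(B : {set T} | (x \in B) && (B \subset A))
                connected_weight B x * weight (A :\: B).
Proof.
move=> xA; rewrite {1}/weight.
rewrite (partition_big (fun ul : {perm T} * {perm T} => component ul.1 ul.2 x)
  (fun B : {set T} => (x \in B) && (B \subset A))) /=.
  by apply: eq_bigr => B /andP[xB BA]; apply: weight_component.
move=> [u l] /=; rewrite in_setX => /andP[uA lA]; rewrite component_id /=.
by apply: component_min => // y; apply: matching_stable.
Qed.

End Components.

(** * Cyclic permutations of a set *)

Section CyclicPerms.

Variable T : finType.
Implicit Types (A B C : {set T}) (p q u l : {perm T}) (x y z : T).

Definition cyclic_on B x : {set {perm T}} :=
  [set p | perm_on B p & porbit p x == B].

Lemma cyclic_traject B x p : x \in B -> p \in cyclic_on B x ->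
  let c := traject p x #|B| in
  [/\ c = x :: behead c, uniq c, c =i B & fcycle p c].
Proof.
move=> xB; rewrite inE => /andP[pB /eqP oB] c.
have cE : c = x :: behead c.
  by rewrite /c; case: #|B| (cardD1 x B) => [|k]; rewrite ?xB.
split=> //; first by rewrite /c -oB uniq_traject_porbit.
  by move=> z; rewrite /c -oB porbit_traject.
rewrite /c; case E: #|B| => [|k] //=.
rewrite -[X in rcons _ X](iter_porbit p x).
by rewrite oB E iterSr -trajectSr fpath_traject.
Qed.

(** Listing the cycle from [x] on identifies the cyclic permutations of [B]
    with the orderings of [B] minus [x]. *)
Lemma card_cyclic_on B x : x \in B -> #|cyclic_on B x| = (#|B|.-1)`!.
Proof.
move=> xB; pose e := enum (B :\ x); pose k := #|B|.
have sz_e : size e = k.-1 by rewrite -cardE /k (cardsD1 x B) xB.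
pose g p := behead (traject p x k).
rewrite cardE -(size_map g) -sz_e -size_permutations ?enum_uniq //.
apply/perm_size/uniq_perm; first 1 last.
- exact: permutations_uniq.
- move=> s; rewrite mem_permutations; apply/mapP/idP => [[p] | s_e].
    rewrite mem_enum => /(cyclic_traject xB)[cE Uc cB _] ->.
    move: cB Uc; rewrite cE => cB /=; rewrite -/k -/(g p) => /andP[x_g Ug].
    apply: uniq_perm; rewrite ?enum_uniq // => z.
    rewrite mem_enum !inE -cB inE; case: eqP => // ->.
    by rewrite (negbTE x_g).
  have Uc : uniq (x :: s).
    by rewrite /= (perm_uniq s_e) enum_uniq (perm_mem s_e) mem_enum !inE eqxx.
  have cB : x :: s =i B.
    by move=> z; rewrite inE (perm_mem s_e) mem_enum !inE; case: eqP => // ->.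
  pose p := perm (can_inj (prev_next Uc)).
  have pE z : p z = next (x :: s) z by rewrite permE.
  have pc : fcycle p (x :: s) by rewrite (eq_fcycle pE) cycle_next.
  have sz_s : k = (size s).+1 by rewrite /k -(eq_card cB) (card_uniqP Uc).
  exists p.
    rewrite mem_enum inE; apply/andP; split.
      apply/subsetP => z; rewrite inE; apply: contraNT; rewrite -cB => zc.
      by rewrite pE next_nth (negbTE zc).
    rewrite eqEsubset porbit_min //=; last first.
      by move=> y; rewrite -!cB pE mem_next.
    apply/subsetP => z; rewrite -cB -(fconnect_cycle pc (mem_head _ _)).
    by move/iter_findex <-; rewrite -permX mem_porbit.
  rewrite /g sz_s /=; move: pc => /= /fpathE.
  by rewrite size_rcons trajectSr => /rcons_inj[].
rewrite map_inj_in_uniq ?enum_uniq // => p q; rewrite !mem_enum => pC qC.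
have [pE Up pB pc] := cyclic_traject xB pC.
have [qE Uq qB qc] := cyclic_traject xB qC.
move=> pq; have {}pq : traject p x #|B| = traject q x #|B|.
  by rewrite pE qE -/k -/(g p) pq.
move: pC qC; rewrite !inE => /andP[pB' _] /andP[qB' _].
apply/permP => z; case zB: (z \in B).
  by rewrite -(nextE pc) ?pB // pq (nextE qc) ?qB.
by rewrite (out_perm pB') ?zB // (out_perm qB') ?zB.
Qed.

End CyclicPerms.

(** * Pairs of involutions forming one path *)

Section Paths.

Variable T : finType.
Implicit Types (A B C : {set T}) (p q u l : {perm T}) (x y z : T).

Definition path_pairs B x :=
  [set ul in connected_pairs B x | porbit (ul.1 * ul.2) x == B].

Definition cycle_pairs B x :=
  [set ul in connected_pairs B x | porbit (ul.1 * ul.2) x != B].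

Lemma connected_pairsP B x u l :
  reflect [/\ u \in matching B, l \in matching B & component u l x = B]
          ((u, l) \in connected_pairs B x).
Proof.
apply: (iffP setIdP); rewrite in_setX /= => -[].
  by case/andP=> uB lB /eqP.
by move=> -> -> ->.
Qed.

Lemma cycleC p a b : a \in <[p]>%g -> b \in <[p]>%g -> (a * b = b * a)%g.
Proof. by move=> pa pb; apply: (centsP (cycle_abelian p)). Qed.

Lemma cyclic_on_cycleP B x p z : p \in cyclic_on B x ->
  reflect (exists2 a, a \in <[p]>%g & a x = z) (z \in B).
Proof.
rewrite inE => /andP[_ /eqP <-]; apply: (iffP (porbitP _ _ _)) => -[].
  by move=> m ->; exists (p ^+ m)%g; rewrite ?mem_cycle.
by move=> _ /cycleP[m ->] <-; exists m.
Qed.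

(** Every [z] in [B] is [a x] for some power [a] of [p], and the reflection has
    to send it to [a^-1 y]; this does not depend on the choice of [a] because
    the powers of [p] commute. *)
Lemma reflection_exists B x y p : x \in B -> y \in B -> p \in cyclic_on B x ->
  exists2 u, (u, (u * p)%g) \in path_pairs B x & u x = y.
Proof.
move=> xB yB pB; have /setIdP[p_on /eqP oB] := pB.
have [c pc cx] := cyclic_on_cycleP y pB yB.
pose f z := if [pick a in <[p]>%g | a x == z] is Some a then (a^-1)%g y else z.
have fE a : a \in <[p]>%g -> f (a x) = (c * a^-1)%g x.
  move=> pa; rewrite /f; case: pickP => [b /andP[pb /eqP e] | /(_ a)].
    rewrite -cx -permM (cycleC pc) ?groupV // (cycleC pc) ?groupV // !permM.
    congr (c _); apply: (canLR (permK _)).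
    by rewrite -permM (cycleC _ pb) ?groupV // permM e permK.
  by rewrite pa eqxx.
have fout z : z \notin B -> f z = z.
  move=> zB; rewrite /f; case: pickP => // a /andP[pa /eqP e].
  by case/(cyclic_on_cycleP z pB): zB; exists a.
have ff : involutive f.
  move=> z; have [/(cyclic_on_cycleP z pB)[a pa <-] | zB] := boolP (z \in B).
    rewrite fE // fE ?groupM ?groupV // invMg invgK.
    by rewrite (cycleC pa) ?groupV // mulKVg.
  by rewrite !fout.
pose u := perm (inv_inj ff); exists u; last first.
  by rewrite permE -[x in LHS]perm1 fE ?group1 // invg1 mulg1.
have uu : involutive u by move=> z; rewrite !permE ff.
have uB : perm_on B u.
  by apply/subsetP => z; rewrite inE permE; apply: contraNT => /fout->.
have lB : perm_on B (u * p)%g by rewrite perm_onM.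
have ll : involutive (u * p)%g.
  move=> z; have [/(cyclic_on_cycleP z pB)[a pa <-] | zB] := boolP (z \in B).
    rewrite !permM !permE fE // -permM fE ?groupM ?groupV ?cycle_id //.
    rewrite -permM; congr ((_ : {perm T}) x).
    rewrite (cycleC pc (groupVr pa)) -[X in (c * X^-1)%g]mulgA.
    rewrite invMg invgK -mulgA.
    rewrite (cycleC _ (cycle_id p)) ?groupM ?groupV ?groupM ?cycle_id //.
    by rewrite mulgA mulKVg.
  by rewrite !(out_perm lB).
have up : (u * (u * p) = p)%g by apply/permP => z; rewrite !permM uu.
rewrite inE /= up oB eqxx andbT; apply/connected_pairsP; split.
- exact/matchingP.
- exact/matchingP.
rewrite /component up oB; apply/setUidPl.
by rewrite porbit_min ?perm_closed // => z; rewrite perm_closed.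
Qed.

(** The pair is determined by the cycle [u * l] and the image [u x], since [u]
    inverts the cycle; conversely both can be prescribed. *)
Lemma card_path_pairs B x : x \in B ->
  #|path_pairs B x| = (#|B|.-1)`! * #|B|.
Proof.
move=> xB; rewrite -(card_cyclic_on xB) -cardsX.
pose h (ul : {perm T} * {perm T}) := ((ul.1 * ul.2)%g, ul.1 x).
have injh : {in path_pairs B x &, injective h}.
  move=> [u l] [u' l'] /setIdP[/connected_pairsP[uB lB _] /eqP /= oB].
  move=> /setIdP[/connected_pairsP[uB' lB' _] /eqP /= oB'] [ep ex].
  have [uon uu] := matchingP _ _ uB; have [lon ll] := matchingP _ _ lB.
  have [uon' uu'] := matchingP _ _ uB'; have [lon' ll'] := matchingP _ _ lB'.
  have eu : u = u'.
    apply/permP => z; have [zB | zB] := boolP (z \in B).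
      move: zB; rewrite -oB => /porbitP[m ->].
      by rewrite {2}ep !dihedral_exp // ex ep.
    by rewrite (out_perm uon) // (out_perm uon').
  by rewrite eu in ep *; rewrite (mulgI _ _ _ ep).
rewrite -(card_in_imset injh); apply: eq_card => -[p y].
rewrite in_setX; apply/imsetP/andP => [[[u l]] | [pB yB]].
  case/setIdP => /connected_pairsP[uB lB _] /= oB [-> ->].
  rewrite (matching_stable uB) // inE oB andbT; split=> //.
  by rewrite perm_onM //; [case/matchingP: uB | case/matchingP: lB].
have [u ul ux] := reflection_exists xB yB pB.
have /setIdP[/connected_pairsP[/matchingP[_ uu] _ _] _] := ul.
exists (u, (u * p)%g); rewrite // /h /= ux; congr (_, _).
by apply/permP => z; rewrite !permM uu.
Qed.

(** A reflection of a cycle of odd size has exactly one fixed point: if [u x] is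
    the rotation of [x] by [2 * h] steps, it is the rotation by [h] steps.  For
    even size [odd_ends] requires an odd orbit and so is empty. *)
Lemma path_odd_ends B x u l : x \in B -> (u, l) \in path_pairs B x ->
  #|odd_ends u l :&: B| = odd #|B|.
Proof.
move=> xB /setIdP[/connected_pairsP[uB lB _] /eqP /= oB].
have [uon uu] := matchingP _ _ uB; have [lon ll] := matchingP _ _ lB.
have oy y : y \in B -> porbit (u * l) y = B.
  by move=> yB; rewrite -[RHS]oB; apply/eqP; rewrite eq_porbit_mem oB.
have [ev | od] := boolP (~~ odd #|B|).
  rewrite (negbTE ev); apply/eqP; rewrite cards_eq0 -subset0.
  apply/subsetP => y /setIP[/[!inE] /andP[_ +] yB].
  by rewrite oy // (negbTE ev).
rewrite negbK in od; rewrite od.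
have [h e] : exists h, u x = ((u * l) ^+ (h + h))%g x.
  have: u x \in porbit (u * l) x by rewrite oB perm_closed.
  case/porbitP => j ->; case oj: (odd j).
    (* turning once more around the odd cycle makes the exponent even *)
    exists (j + #|B|)./2; rewrite addnn even_halfK ?oddD ?oj ?od //.
    by rewrite addnC expgD permM -oB -[#|_|]mul1n porbit_expM.
  by exists j./2; rewrite addnn even_halfK // oj.
pose y := ((u * l) ^+ h)%g x.
have yB : y \in B by rewrite -oB mem_porbit.
have uy : u y = y by rewrite dihedral_exp // e expgD permM permK.
apply/eqP/cards1P; exists y; apply/setP => z; rewrite !inE.
apply/idP/eqP => [/andP[/andP[/eqP uz _] zB] | ->].
  by apply: (@odd_fixed_eq _ u l) => //; rewrite oy.
by rewrite uy eqxx yB oy ?od.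
Qed.

End Paths.

(** * Pairs of involutions forming one cycle *)

Section Cycles.

Variable T : finType.
Implicit Types (A B C : {set T}) (p q u l : {perm T}) (x y z : T).

(** The step along the cycle that leaves [x] by its [u]-edge: every second
    vertex, counted from [x], is in the rotation orbit of [x] and is left by its
    [u]-edge, the others by their [l]-edge. *)
Definition cycle_walk u l x z := if z \in porbit (u * l) x then u z else l z.

(** A total choice of permutation, meaningful for injective [f], which allows
    to name the walk of a pair without a proof of injectivity. *)
Definition perm_of (f : T -> T) : {perm T} :=
  odflt 1%g [pick p : {perm T} | [forall z, p z == f z]].

Lemma perm_ofE f : injective f -> perm_of f =1 f.
Proof.
move=> injf; rewrite /perm_of.
case: pickP => [p /forallP pf z | /(_ (perm injf))].
  exact/eqP.
by move/forallP => []; move=> z; rewrite permE.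
Qed.

Section CyclePair.

Variables (B : {set T}) (x : T) (u l : {perm T}).
Hypothesis cyc : (u, l) \in cycle_pairs B x.

Let C := porbit (u * l) x.

(** The two rotation orbits that form the component are distinct, as their
    union is not the orbit of [x]; [u] exchanges them. *)
Lemma cycle_pair_swap z : z \in B -> (u z \in C) = (z \notin C).
Proof.
have /setIdP[/connected_pairsP[uB lB cB] /= neq] := cyc.
have [_ uu] := matchingP _ _ uB; have [_ ll] := matchingP _ _ lB.
have CU : [disjoint C & porbit (u * l) (u x)].
  apply/pred0P => w /=; apply: contraNF neq => /andP[].
  rewrite -!eq_porbit_mem => /eqP ew /eqP ew'.
  by rewrite -[X in _ == X]cB /component -ew' ew setUid.
have uC w : (u w \in C) = (w \in porbit (u * l) (u x)).
  by rewrite -[in RHS](uu w) dihedral_porbit.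
rewrite -cB inE uC -/C; case/orP => zC; last by rewrite zC (disjointFl CU).
by rewrite zC (disjointFr CU).
Qed.

Lemma cycle_pair_swapl z : z \in B -> (l z \in C) = (z \notin C).
Proof.
have /setIdP[/connected_pairsP[uB lB cB] /= neq] := cyc => zB.
have [_ uu] := matchingP _ _ uB.
rewrite -cycle_pair_swap // /C -porbitV_stable.
have [_ ll] := matchingP _ _ lB; rewrite -mulg_invol //.
by rewrite permM ll.
Qed.

Lemma odd_ends_cycle : odd_ends u l :&: B = set0.
Proof.
apply/setP => z; rewrite !inE; apply/negbTE/negP => /andP[/andP[/eqP uz _] zB].
by have := cycle_pair_swap zB; rewrite uz; case: (z \in C).
Qed.

Lemma cycle_pair_even : ~~ odd #|B|.
Proof.
have /setIdP[/connected_pairsP[uB lB cB] /= neq] := cyc.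
have -> : #|B| = #|B :&: C| + #|B :\: C| by rewrite cardsID.
have -> : B :\: C = u @: (B :&: C).
  have [_ uu] := matchingP _ _ uB.
  apply/setP => z; apply/setDP/imsetP => [[zB zC] | [w /setIP[wB wC] ->]].
    exists (u z); last by rewrite uu.
    by rewrite inE (matching_stable uB) // cycle_pair_swap.
  by rewrite (matching_stable uB) // cycle_pair_swap // wC.
by rewrite card_imset ?addnn ?odd_double //; apply: perm_inj.
Qed.

Local Notation walk := (cycle_walk u l x).

Lemma walk_inj : injective walk.
Proof.
have /setIdP[/connected_pairsP[uB lB cB] /= neq] := cyc.
have CB : {subset C <= B} by apply/subsetP; rewrite -cB subsetUl.
have lC z : z \notin C -> (l z \in C) = (z \in B).
  move=> zC; case zB: (z \in B); first by rewrite cycle_pair_swapl.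
  by rewrite (matching_out lB) ?zB // (negbTE zC).
have swap z w : z \in C -> w \notin C -> u z <> l w.
  move=> zC wC e; have := cycle_pair_swap (CB _ zC); rewrite zC e lC // => wB.
  have : l w \in B by rewrite -e (matching_stable uB) // CB.
  by rewrite perm_closed ?wB //; case/matchingP: lB.
move=> z w; rewrite /cycle_walk; case: ifPn => zC; case: ifPn => wC.
- exact: perm_inj.
- by move/swap => [].
- by move/esym/swap => [].
- exact: perm_inj.
Qed.

(** The rotation is two steps of the walk, hence the walk determines the
    rotation orbit of [x], and then both involutions. *)
Lemma walkP (q : {perm T}) : q =1 walk ->
  [/\ q \in cyclic_on B x, C = porbit (q * q) x
    & forall z, u z = (if z \in C then q z else (q^-1)%g z) /\
                l z = (if z \in C then (q^-1)%g z else q z)].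
Proof.
move=> qE.
have /setIdP[/connected_pairsP[uB lB cB] /= neq] := cyc.
have CB : {subset C <= B} by apply/subsetP; rewrite -cB subsetUl.
have [uon uu] := matchingP _ _ uB; have [lon ll] := matchingP _ _ lB.
have xC : x \in C by apply: porbit_id.
have q2 z : z \in C -> (u * l)%g z = (q * q)%g z.
  move=> zC; rewrite !permM !qE /cycle_walk zC.
  by rewrite cycle_pair_swap ?zC ?CB.
have Cq2 : C = porbit (q * q) x.
  apply: (@eq_in_porbit _ _ _ C) => // z zC; by rewrite porbit_stable.
have qon : perm_on B q.
  apply/subsetP => z; rewrite inE; apply: contraNT => zB.
  rewrite qE /cycle_walk; case: ifP => zC; first by rewrite CB in zB.
  by rewrite (matching_out lB).
split=> //.
  rewrite inE qon eqEsubset porbit_min -?cB ?component_id //=; last first.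
    by rewrite cB => z; rewrite perm_closed.
  have Cq z : z \in C -> z \in porbit q x.
    rewrite Cq2 => /porbitP[m ->]; have -> : (q * q = q ^+ 2)%g by [].
    by rewrite -expgM mem_porbit.
  apply/subsetP => z; rewrite cB => zB.
  have [/Cq //| zC] := boolP (z \in C).
  have uzC : u z \in C by rewrite cycle_pair_swap.
  have -> : z = q (u z) by rewrite qE /cycle_walk uzC uu.
  by rewrite porbit_stable Cq.
move=> z; case: ifPn => zC; split;
  rewrite ?qE /cycle_walk -/C ?zC ?(negbTE zC) //;
  apply: (canRL (permK q)); rewrite qE /cycle_walk -/C.
  by rewrite cycle_pair_swapl ?zC ?CB // ll.
have [zB|zB] := boolP (z \in B); first by rewrite cycle_pair_swap ?zC // uu.
by rewrite !(out_perm uon) // (negbTE zC) (out_perm lon).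
Qed.

End CyclePair.

(** Along a cycle of even length the parity of the position is well defined,
    and the even positions form the orbit of the square. *)
Lemma cyclic_parity B x q : x \in B -> q \in cyclic_on B x -> ~~ odd #|B| ->
  forall z, z \in B -> (q z \in porbit (q * q) x) = (z \notin porbit (q * q) x).
Proof.
move=> xB /setIdP[_ /eqP oB] ev.
have par a b : (q ^+ a)%g x = (q ^+ b)%g x -> odd a = odd b.
  wlog ab : a b / a <= b.
    by move=> H e; case/orP: (leq_total a b) => /H ->.
  rewrite -[b in RHS](subnK ab) expgD permM => /perm_inj/esym/dvdn_porbit.
  rewrite oB => /(dvdn_odd)/contraNN-/(_ ev); rewrite oddB //.
  by case: (odd a); case: (odd b).
have inC m : ((q ^+ m)%g x \in porbit (q * q) x) = ~~ odd m.
  have q2 : (q * q = q ^+ 2)%g by [].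
  apply/porbitP/idP => [[i] | em].
    by rewrite q2 -expgM => /par->; rewrite oddM.
  by exists m./2; rewrite q2 -expgM mul2n even_halfK.
move=> z; rewrite -oB => /porbitP[m ->].
by rewrite -permM -expgSr !inC.
Qed.

(** The walk is a bijection onto the cyclic permutations of [B].  From a cyclic
    permutation [q] of even size the pair is recovered by matching each even
    position with the next one for [u] and with the previous one for [l]. *)
Lemma card_cycle_pairs B x : x \in B ->
  #|cycle_pairs B x| = if odd #|B| then 0 else (#|B|.-1)`!.
Proof.
move=> xB; case: ifPn => [od | ev].
  apply/eqP; rewrite cards_eq0 -subset0; apply/subsetP => -[u l].
  by move/cycle_pair_even; rewrite od.
rewrite -(card_cyclic_on xB).
pose C q := porbit (q * q) x.
pose half b q z := if (z \in C q) == b then q z else (q^-1)%g z.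
have CB q : q \in cyclic_on B x -> {subset C q <= B}.
  move=> qB; have /setIdP[qon _] := qB.
  apply/subsetP; apply: porbit_min => // y.
  by rewrite permM !perm_closed.
have qVC q z : q \in cyclic_on B x -> z \in B ->
    ((q^-1)%g z \in C q) = (z \notin C q).
  move=> qB zB; have /setIdP[qon _] := qB.
  rewrite -[in RHS](permKV q z) (cyclic_parity xB) ?negbK //.
  by rewrite perm_closed ?perm_onV.
have half_out b q z : q \in cyclic_on B x -> z \notin B -> half b q z = z.
  move=> /setIdP[qon _] zB; rewrite /half !(out_perm _ zB) ?perm_onV //.
  by case: ifP.
have half_invol b q : q \in cyclic_on B x -> involutive (half b q).
  move=> qB z; have [zB | zB] := boolP (z \in B); last by rewrite !half_out.
  rewrite /half; case: (boolP ((z \in C q) == b)) => e.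
    by rewrite (cyclic_parity xB) // -(eqP e) permK; case: (z \in C q).
  rewrite qVC // permKV; case: b (z \in C q) e => -[] //.
pose h (ul : {perm T} * {perm T}) := perm_of (cycle_walk ul.1 ul.2 x).
have hP u l : (u, l) \in cycle_pairs B x -> h (u, l) =1 cycle_walk u l x.
  by move/walk_inj/perm_ofE.
have injh : {in cycle_pairs B x &, injective h}.
  move=> [u l] [u' l'] cu cu' e.
  have [_ Ce uE] := walkP cu (hP _ _ cu).
  have [_ Ce' uE'] := walkP cu' (hP _ _ cu').
  rewrite -e in Ce' uE'; congr (_, _); apply/permP => z.
    by rewrite (uE z).1 (uE' z).1 Ce Ce'.
  by rewrite (uE z).2 (uE' z).2 Ce Ce'.
rewrite -(card_in_imset injh); apply: eq_card => q; apply/imsetP/idP.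
  by case=> -[u l] cu ->; have [] := walkP cu (hP _ _ cu).
move=> qB; have /setIdP[qon /eqP oB] := qB.
pose u := perm (inv_inj (half_invol true q qB)).
pose l := perm (inv_inj (half_invol false q qB)).
have uu : involutive u by move=> z; rewrite !permE half_invol.
have ll : involutive l by move=> z; rewrite !permE half_invol.
have on b (p : {perm T}) : p =1 half b q -> perm_on B p.
  move=> pE; apply/subsetP => z; rewrite inE pE.
  by apply: contraNT => /half_out->.
have uB : u \in matching B.
  by apply/matchingP; split=> //; apply: (on true) => z; rewrite permE.
have lB : l \in matching B.
  by apply/matchingP; split=> //; apply: (on false) => z; rewrite permE.
have xC : x \in C q by apply: porbit_id.
have Cul : porbit (u * l) x = C q.
  apply/esym/(@eq_in_porbit _ _ _ (C q)) => // z zC.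
    by rewrite porbit_stable.
  rewrite !permM !permE /half zC eqxx (cyclic_parity xB) ?(CB q) //.
  by rewrite zC.
have walkE z : q z = cycle_walk u l x z.
  by rewrite /cycle_walk Cul !permE /half; case: (z \in C q).
exists (u, l); last first.
  apply/permP => z; rewrite perm_ofE -?walkE // => z1 z2.
  by rewrite -!walkE; apply: perm_inj.
rewrite inE /= Cul; apply/andP; split; last first.
  apply: contraTneq (xC) => e.
  have := cyclic_parity xB qB ev xB; rewrite -/(C q) xC e perm_closed //.
  by rewrite xB.
apply/connected_pairsP; split=> //.
apply/eqP; rewrite eqEsubset component_min //=; last 2 first.
- by move=> y; apply: matching_stable.
- by move=> y; apply: matching_stable.
rewrite -oB; apply: porbit_min; first exact: component_id.
move=> y /(component_stable uu ll)[uy ly].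
by rewrite walkE /cycle_walk; case: ifP.
Qed.

End Cycles.

(** * The recurrence *)

Definition connected_count k : nat :=
  if odd k then 2 * k`! else k.-1`! * k.+1.

(** For odd [k] there are only paths, each of weight 2 as its ends may be joined
    or not; for even [k] each cyclic permutation accounts for [k] paths and one
    cycle, all of weight 1. *)
Lemma connected_weightE (T : finType) (B : {set T}) x : x \in B ->
  connected_weight B x = connected_count #|B|.
Proof.
move=> xB; rewrite /connected_weight (bigID (mem (path_pairs B x))) /=.
rewrite (eq_bigl (mem (path_pairs B x))); last first.
  by move=> ul; rewrite andb_idl // => /setIdP[].
rewrite [X in _ + X](eq_bigl (mem (cycle_pairs B x))); last first.
  move=> ul; rewrite /= [in RHS]inE [ul \in path_pairs _ _]inE.
  by case: (ul \in connected_pairs _ _).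
rewrite (eq_bigr (fun=> 2 ^ odd #|B|)); last first.
  by case=> u l /(path_odd_ends xB)->.
rewrite [X in _ + X](eq_bigr (fun=> 1)); last first.
  by case=> u l /odd_ends_cycle->; rewrite cards0.
rewrite !sum_nat_const card_path_pairs // card_cycle_pairs // muln1.
have B_gt0 : 0 < #|B| by apply/card_gt0P; exists x.
rewrite /connected_count; case: ifP => _.
  rewrite addn0 [RHS]mulnC -[in RHS](prednK B_gt0) factS prednK //.
  by rewrite [#|B| * _]mulnC.
by rewrite expn0 muln1 mulnS addnC.
Qed.

Lemma sum_subsets_card (T : finType) (E : {set T}) (F : nat -> nat) :
  \sum_(D : {set T} | D \subset E) F #|D|
    = \sum_(k < #|E|.+1) 'C(#|E|, k) * F k.
Proof.
rewrite (partition_big (fun D : {set T} => inord #|D| : 'I_#|E|.+1) xpredT) //=.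
apply: eq_bigr => k _; rewrite -cards_draws -sum_nat_const.
have sz (D : {set T}) : D \subset E -> (inord #|D| == k) = (#|D| == k).
  by move=> /subset_leq_card DE; rewrite -val_eqE /= inordK.
apply: eq_big => [D | D /andP[DE]].
  by rewrite inE; case: (boolP (D \subset E)) => //= /sz.
by rewrite sz // => /eqP->.
Qed.

Lemma sum_pointed_subsets (T : finType) (A : {set T}) x (F : nat -> nat) :
    x \in A ->
  \sum_(B : {set T} | (x \in B) && (B \subset A)) F #|B|
    = \sum_(k < #|A|) 'C(#|A|.-1, k) * F k.+1.
Proof.
move=> xA; rewrite (cardsD1 x A) xA /= -(sum_subsets_card _ (F \o S)) /=.
rewrite (reindex_onto (fun D => x |: D) (fun B => B :\ x)) /=; last first.
  by move=> B /andP[xB _]; rewrite setD1K.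
apply: eq_big => [D | D /andP[_ /eqP e]]; last first.
  by rewrite cardsU1 -{1}e setD11.
rewrite setU11 subUset sub1set xA subsetD1 /=; congr (_ && _).
by apply/eqP/idP => [<- | /setU1K //]; rewrite setD11.
Qed.

Lemma weight_set0 (T : finType) (A : {set T}) : #|A| = 0 -> weight A = 1.
Proof.
move=> /eqP; rewrite cards_eq0 => /eqP ->; rewrite /weight.
have M u : (u \in matching (set0 : {set T})) = (u == 1%g).
  apply/idP/eqP => [/matchingP[u0 _] | ->].
    by apply: (perm_on_id u0); rewrite cards0.
  by apply/matchingP; split=> [|y]; rewrite ?perm_on1 // !perm1.
rewrite (big_pred1 (1%g, 1%g)) => [|[u l]]; first by rewrite setI0 cards0.
by rewrite in_setX !M.
Qed.

Definition recurrence_rhs n :=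
  \sum_(k < n) 'C(n.-1, k) * (connected_count k.+1 * e_PB (n - k.+1)).

Lemma weight_recurrence (T : finType) (A : {set T}) : 0 < #|A| ->
    (forall D : {set T}, #|D| < #|A| -> weight D = e_PB #|D|) ->
  weight A = recurrence_rhs #|A|.
Proof.
case/card_gt0P => x xA IH; rewrite (weight_rec xA).
rewrite /recurrence_rhs.
rewrite -(sum_pointed_subsets
            (fun k => connected_count k * e_PB (#|A| - k)) xA).
apply: eq_bigr => B /andP[xB BA]; rewrite connected_weightE // IH.
  by rewrite cardsD (setIidPr BA).
rewrite cardsD (setIidPr BA) ltn_subrL.
by apply/andP; split; apply/card_gt0P; exists x.
Qed.

(** The recurrence expresses the weight through cardinals alone, so by induction
    it only depends on the cardinal: this dispenses with transporting pairs
    along bijections. *)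
Lemma weight_card (T : finType) (A : {set T}) : weight A = e_PB #|A|.
Proof.
have [n] := ubnP #|A|; elim: n T A => // n IHn T A; rewrite ltnS => leAn.
have [A0 | A_gt0] := posnP #|A|.
  by rewrite e_PB_weight !weight_set0 ?cardsT ?card_ord.
rewrite e_PB_weight !weight_recurrence ?cardsT ?card_ord // => D ltD;
  apply: IHn; exact: leq_trans ltD leAn.
Qed.

Lemma e_PB_rec n : 0 < n -> e_PB n = recurrence_rhs n.
Proof.
move=> n_gt0; rewrite e_PB_weight weight_recurrence ?cardsT ?card_ord //.
by move=> D _; apply: weight_card.
Qed.

Lemma sum_parity (G : nat -> nat) n : 0 < n ->
  \sum_(k < n) G k.+1 = \sum_(1 <= i < (n %/ 2).+1) G (2 * i)
    + \sum_(0 <= i < ((n - 1) %/ 2).+1) G (2 * i + 1).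
Proof.
case: n => // n _; elim: n => [|n IHn].
  by rewrite big_ord1 big_geq // big_nat1.
rewrite big_ord_recr IHn /= !subn1 /=; case on: (odd n).
  have -> : n.+2 %/ 2 = n.+1 %/ 2 by lia.
  have -> : n.+1 %/ 2 = (n %/ 2).+1 by lia.
  rewrite [in RHS](@big_nat_recr _ _ _ _ 0) //= -addnA.
  by congr (_ + (_ + G _)); lia.
have -> : n.+1 %/ 2 = n %/ 2 by lia.
have -> : n.+2 %/ 2 = (n %/ 2).+1 by lia.
rewrite [in RHS](@big_nat_recr _ _ _ _ 1) //= addnAC.
by congr (_ + G _ + _); lia.
Qed.

Theorem theorem24 :
  e_PB 0 = 1 /\
  forall n : nat, 1 <= n ->
    e_PB n =
      \sum_(1 <= i < (n %/ 2).+1)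
        'C(n - 1, 2 * i - 1) * (2 * i + 1) * (2 * i - 1)`! * e_PB (n - 2 * i)
      + 2 * \sum_(0 <= i < ((n - 1) %/ 2).+1)
          'C(n - 1, 2 * i) * (2 * i + 1)`! * e_PB (n - 2 * i - 1).
Proof.
split=> [|n n_gt0]; first by rewrite e_PB_weight weight_set0 ?cardsT ?card_ord.
rewrite e_PB_rec // /recurrence_rhs.
pose G k := 'C(n.-1, k.-1) * (connected_count k * e_PB (n - k)).
rewrite (eq_bigr (fun k : 'I_n => G k.+1)) // sum_parity // big_distrr /=.
congr (_ + _); apply: eq_big_nat => i /andP[i_gt0 _];
  rewrite /G /connected_count.
  rewrite oddM /= !subn1 -!mulnA; congr (_ * _).
  by rewrite mulnCA addn1.
by rewrite oddD oddM /= addn1 /= subnS !subn1 -!mulnA mulnCA.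
Qed.
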